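(* Let $P_\lambda=P_{\mathrm{MCP},\lambda}$ with parameters $a>0$, $\lambda>0$. (a) The problem $$\min_{\beta\in\Lambda}\ \mathcal L(\beta)=\tfrac12\beta^\top Q\beta+q^\top\beta+n\sum_{i=1}^d P_\lambda(|\beta_i|)$$ is equivalent to the program $$\min_{\beta\in\Lambda,\ g\in[0,a\lambda]^d}\ \mathcal F_{\mathrm{MCP}}(\beta,g),$$ i.e. $\beta$ is a global minimizer of the first problem if and only if there exists $g\in[0,a\lambda]^d$ such that $(\beta,g)$ is a global minimizer of the second problem. (b) For any $\theta\ge0$, the first derivative of the MCP can be written as $P_\lambda'(\theta)=\dfrac{a\lambda-g^*(\theta)}{a}$, where $g^*:\mathbb R_+\to\mathbb R$ is defined by $$g^*(\theta):=\operatorname*{argmin}_{\kappa\in[0,a\lambda]}\Big\{\frac1{2a}\kappa^2-\Big(\frac1a\kappa-\lambda\Big)\theta\Big\}.$$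
   Context: Setting: $n\ge1$ is the sample size, $d\ge1$ the dimension, $0\le m<d$; $Q\in\mathbb R^{d\times d}$ is symmetric (not necessarily positive semidefinite), $q\in\mathbb R^d$, $\mathcal A\in\mathbb R^{d\times m}$ has full rank, $\mathbf b\in\mathbb R^m$, and $\Lambda:=\{\beta\in\mathbb R^d:\mathcal A^\top\beta\le\mathbf b\}$ is nonempty. It is assumed that the problem $\min_{\beta\in\Lambda}\mathcal L(\beta)$ has a finite global solution. MCP: for $a>0$, $\lambda>0$ and $\theta\ge0$, $$P_{\mathrm{MCP},\lambda}(\theta):=\int_0^\theta\frac{(a\lambda-t)_+}{a}\,dt,\qquad (b)_+=\max\{b,0\}.$$ At $\theta=0$, $P_\lambda'$ denotes the right derivative. For $\beta=(\beta_i),g=(g_i)\in\mathbb R^d$, $$\mathcal F_{\mathrm{MCP}}(\beta,g):=\tfrac12\beta^\top Q\beta+q^\top\beta+n\sum_{i=1}^d\Big\{\frac1{2a}g_i^2-\Big(\frac1ag_i-\lambda\Big)|\beta_i|\Big\}.$$ *)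

(* Defs.v *)
From mathcomp Require Import all_boot all_order all_algebra.
From mathcomp Require Import all_classical all_reals all_analysis.

Set Implicit Arguments.
Unset Strict Implicit.
Unset Printing Implicit Defensive.

Import Order.TTheory GRing.Theory Num.Theory.
Import numFieldNormedType.Exports.

Local Open Scope classical_set_scope.
Local Open Scope ring_scope.

Definition argmin (R : realType) (T : Type) (S : set T) (f : T -> R) : set T :=
  [set x | S x /\ forall y, S y -> f x <= f y].

(* Only meaningful for 0 <= theta: the value for theta < 0 is the integral over
   the empty set, i.e. 0. *)
Definition MCP (R : realType) (a lam theta : R) : R :=
  \int[lebesgue_measure]_(t in `[0, theta]) (Num.max (a * lam - t) 0 / a).

(* Derivative of a function that only matters on the half-line [0, +oo[: the
   two-sided derivative at x > 0, the right derivative at x = 0. *)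
Definition is_derive_halfline (R : realType) (f : R -> R) (x l : R) : Prop :=
  if x == 0 then h^-1 * (f h - f 0) @[h --> 0^'+] --> l
  else is_derive x 1 f l.

Definition Lambda (R : realType) (d m : nat) (A : 'M[R]_(d, m)) (b : 'cV[R]_m) :
    set 'cV[R]_d :=
  [set beta | forall j, (A^T *m beta) j 0 <= b j 0].

Definition quad_lin (R : realType) (d : nat) (Q : 'M[R]_d) (q beta : 'cV[R]_d) : R :=
  2^-1 * (beta^T *m Q *m beta) 0 0 + (q^T *m beta) 0 0.

Definition L_obj (R : realType) (n d : nat) (Q : 'M[R]_d) (q : 'cV[R]_d)
    (P : R -> R) (beta : 'cV[R]_d) : R :=
  quad_lin Q q beta + n%:R * \sum_(i < d) P `|beta i 0|.

Definition F_MCP (R : realType) (n d : nat) (Q : 'M[R]_d) (q : 'cV[R]_d)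
    (a lam : R) (beta g : 'cV[R]_d) : R :=
  quad_lin Q q beta +
  n%:R * \sum_(i < d)
    ((2 * a)^-1 * g i 0 ^+ 2 - (a^-1 * g i 0 - lam) * `|beta i 0|).

Definition cube (R : realType) (d : nat) (u : R) : set 'cV[R]_d :=
  [set g | forall i, g i 0 \in `[0, u]].

Definition gstar_argmin (R : realType) (a lam theta : R) : set R :=
  argmin `[0, a * lam]
    (fun kappa : R => (2 * a)^-1 * kappa ^+ 2 - (a^-1 * kappa - lam) * theta).

(* [get] chooses an element of the argmin; it is "the" argmin only when that set
   is a singleton, which has to be established separately. *)
Definition gstar (R : realType) (a lam theta : R) : R :=
  get (gstar_argmin a lam theta).

(* Main.v *)
Require Import Defs.
From mathcomp Require Import all_boot all_order all_algebra.
From mathcomp Require Import all_classical all_reals all_analysis.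
From mathcomp Require Import ring lra.

Set Implicit Arguments.
Unset Strict Implicit.
Unset Printing Implicit Defensive.

Import Order.TTheory GRing.Theory Num.Theory.
Import numFieldNormedType.Exports.

Local Open Scope classical_set_scope.
Local Open Scope ring_scope.

(** Everything rests on one completion of squares. Fix [theta >= 0] and put
    [s = a lam - theta], [p = max (s, 0)] and, for a competitor [kappa],
    [u = a lam - kappa >= 0]. Then
      [kappa^2 / (2 a) - (kappa / a - lam) theta
         = (a lam^2 - p^2 / a) / 2 + ((u - p)^2 + 2 u (p - s)) / (2 a)]
    (lemma [mcp_objE]). Since [u >= 0] and [p >= s], the last fraction is at
    least [(u - p)^2 / (2 a)], and it vanishes at [u = p] by the
    complementarity [p (p - s) = 0]. So the objective has the unique minimizer
    [g* = a lam - p] on [[0, a lam]], with minimal value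
    [(a lam^2 - p^2 / a) / 2].

    That minimal value is the MCP itself: as a function of [theta] its
    derivative is [p / a], which is the integrand defining the penalty, and it
    vanishes at [0], so the fundamental theorem of calculus applies
    ([MCP_closed_form]). The derivative formula of (b) follows because
    [a lam - g* = p].

    For (a), the coordinates of [g] are decoupled, so minimizing the augmented
    objective over [g] at fixed [beta] replaces each bracket by the MCP of
    [|beta_i|] and returns the original objective; minimizing jointly is then
    the same as minimizing the partial minimum ([argmin_partial]). *)

(** * Partial minimization *)

(** A joint minimizer [(x, y)] projects to a minimizer of the partial minimum
    because [f x <= F x y <= F x' (s x') = f x'] for every competitor [x'];
    conversely a minimizer [x] of [f] lifts to [(x, s x)]. *)
Lemma argmin_partial (R : realType) (X Y : Type) (S : set X) (T : set Y)
    (f : X -> R) (F : X -> Y -> R) (s : X -> Y) (x : X) :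
    (forall x, T (s x)) -> (forall x, F x (s x) = f x) ->
    (forall x y, T y -> f x <= F x y) ->
  argmin S f x <->
  exists2 y, T y & argmin (S `*` T) (fun z => F z.1 z.2) (x, y).
Proof.
move=> Ts Fs fF; split=> [[Sx minx]|[y Ty [[/= Sx _] minxy]]].
  exists (s x) => //; split=> [|[x' y'] [/= Sx' Ty']] //=.
  by rewrite Fs (le_trans (minx x' Sx'))// fF.
split=> // x' Sx'; rewrite (le_trans (fF x y Ty))// -Fs.
exact: (minxy (x', s x') (conj Sx' (Ts x'))).
Qed.

(** * The closed form of the MCP *)

Lemma is_derive_quadratic_remainder (R : realType) (f : R -> R) (x l C : R) :
    (forall h, `|f (x + h) - f x - h * l| <= C * h ^+ 2) ->
  is_derive x 1 f l.
Proof.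
move=> rem.
have lim_quot : h^-1 *: ((f \o shift x) (h *: (1 : R)) - f x) @[h --> 0^'] --> l.
  apply/cvgrPdist_le => e e0.
  have C0 : 0 <= C by have := rem 1; rewrite expr1n mulr1; apply: le_trans.
  near=> h.
  have h0 : h != 0 by near: h; exact: nbhs_dnbhs_neq.
  (* dividing by [C + 1] rather than [C] covers the case [C = 0] *)
  have hsmall : `|h| <= e / (C + 1).
    near: h; apply: dnbhs0_le; apply: divr_gt0 => //; lra.
  rewrite /= /GRing.scale/= mulr1 distrC (addrC h).
  have -> : h^-1 * (f (x + h) - f x) - l = h^-1 * (f (x + h) - f x - h * l).
    by field.
  rewrite normrM normfV ler_pdivrMl ?normr_gt0//.
  rewrite (le_trans (rem h))// -real_normK ?num_real// expr2 mulrCA.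
  apply: ler_wpM2l => //.
  have : `|h| * (C + 1) <= e by rewrite -ler_pdivlMr//; lra.
  have := normr_ge0 h; nra.
apply: DeriveDef; first by apply/cvg_ex; exists l.
exact: cvg_lim lim_quot.
Unshelve. all: by end_near. Qed.

(** The squared positive part has a 2-Lipschitz derivative, so its first-order
    remainder is at most [h^2]; this bound handles the kink of the positive part
    at [0] together with the other points. *)
Lemma is_derive_pospart_sqr (R : realType) (x : R) :
  is_derive x 1 (fun u : R => Num.max u 0 ^+ 2) (2 * Num.max x 0).
Proof.
apply: (@is_derive_quadratic_remainder _ _ _ _ 1) => h; rewrite mul1r ler_norml.
by rewrite !maxEle; case: (leP (x + h) 0) => ?; case: (leP x 0) => ?;
  apply/andP; split; nra.
Qed.

(** With [p = max (a lam - theta, 0)] this is the usual two-piece formula: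
    [lam theta - theta^2 / (2 a)] up to [a lam], then the constant
    [a lam^2 / 2]. Writing it through [p] makes it differentiable on the whole
    line without any case distinction. *)
Definition mcp_closed (R : realType) (a lam theta : R) : R :=
  (a * lam ^+ 2 - Num.max (a * lam - theta) 0 ^+ 2 / a) / 2.

Lemma is_derive_mcp_closed (R : realType) (a lam theta : R) : 0 < a ->
  is_derive theta 1 (mcp_closed a lam) (Num.max (a * lam - theta) 0 / a).
Proof.
move=> a0.
have dsub : is_derive theta 1 (fun t : R => a * lam - t) (- 1).
  by apply: is_derive_eq; ring.
have dsqr : is_derive theta 1 (fun t : R => Num.max (a * lam - t) 0 ^+ 2)
    (2 * Num.max (a * lam - theta) 0 * - 1).
  exact: (@is_derive1_comp _ (fun u : R => Num.max u 0 ^+ 2)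
    (fun t : R => a * lam - t) _ _ _ (is_derive_pospart_sqr _) dsub).
rewrite (_ : mcp_closed a lam = (fun t => lam ^+ 2 * a / 2 +
    (- (2 * a)^-1) *: Num.max (a * lam - t) 0 ^+ 2)); last first.
  by apply/funext => t; rewrite /mcp_closed /GRing.scale/=; field; rewrite gt_eqF.
apply: is_derive_eq; rewrite /GRing.scale/=; field; rewrite gt_eqF//.
Qed.

(** [mcp_closed a lam] is an antiderivative of the integrand on the whole line
    and vanishes at [0]. *)
Lemma MCP_closed_form (R : realType) (a lam theta : R) :
  0 < a -> 0 < lam -> 0 <= theta -> MCP a lam theta = mcp_closed a lam theta.
Proof.
move=> a0 lam0; have al0 : 0 < a * lam by exact: mulr_gt0.
have F0 : mcp_closed a lam 0 = 0.
  by rewrite /mcp_closed subr0 max_l ?ltW//; field; rewrite gt_eqF.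
rewrite le_eqVlt => /predU1P[<-|theta0].
  by rewrite F0 /MCP set_itv1 Rintegral_set1.
have dF (t : R) := is_derive_mcp_closed lam t a0.
have cF (t : R) : {for t, continuous (mcp_closed a lam)}.
  by apply: differentiable_continuous; apply/derivable1_diffP.
rewrite /MCP /Rintegral (@continuous_FTC2 _ _ (mcp_closed a lam))//.
- by rewrite F0 sube0.
- apply: continuous_subspaceT => t.
  apply: cvgMl.
  apply: (@continuous_max _ _ (fun t : R => a * lam - t) (fun=> 0));
    last exact: cvg_cst.
  by apply: cvgB; [exact: cvg_cst|exact: cvg_id].
- split=> [t _||].
  + exact: ex_derive.
  + exact/cvg_at_right_filter/cF.
  + exact/cvg_at_left_filter/cF.
- by move=> t _; rewrite derive1E; exact: derive_val.
Qed.

(** * The inner minimization over kappa *)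

(** The excess over [mcp_closed] is written in the distances [a lam - kappa] and
    [a lam - theta] to the upper end of the interval, so that it only involves a
    square and a term of known sign. *)
Lemma mcp_objE (R : realType) (a lam theta k : R) : 0 < a ->
  (2 * a)^-1 * k ^+ 2 - (a^-1 * k - lam) * theta =
  mcp_closed a lam theta + (2 * a)^-1 *
    ((a * lam - k - Num.max (a * lam - theta) 0) ^+ 2 +
     2 * (a * lam - k) * (Num.max (a * lam - theta) 0 - (a * lam - theta))).
Proof. by move=> a0; rewrite /mcp_closed; field; rewrite gt_eqF. Qed.

(** This is [min (theta, a lam)], for [theta >= 0] the projection of [theta] on
    [[0, a lam]]; in the present form [a lam - mcp_argmin] is visibly the
    numerator of the derivative. *)
Definition mcp_argmin (R : realType) (a lam theta : R) : R :=
  a * lam - Num.max (a * lam - theta) 0.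

Lemma mcp_argmin_in (R : realType) (a lam theta : R) :
  0 < a -> 0 < lam -> 0 <= theta -> mcp_argmin a lam theta \in `[0, a * lam].
Proof.
move=> a0 lam0 theta0; have al0 : 0 < a * lam by exact: mulr_gt0.
by rewrite in_itv/= /mcp_argmin maxEle; case: (leP (_ - _) 0) => ?;
  apply/andP; split; lra.
Qed.

Lemma mcp_obj_argmin (R : realType) (a lam theta : R) : 0 < a ->
  let k := mcp_argmin a lam theta in
  (2 * a)^-1 * k ^+ 2 - (a^-1 * k - lam) * theta = mcp_closed a lam theta.
Proof.
move=> a0 k; rewrite mcp_objE// -[RHS]addr0; congr (_ + _).
by rewrite /k /mcp_argmin maxEle; case: leP => _; ring.
Qed.

(** Quadratic growth around the minimizer: it gives minimality and uniqueness at
    once. The constraint [k <= a lam] is what makes the cross term of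
    [mcp_objE] nonnegative. *)
Lemma mcp_obj_ge (R : realType) (a lam theta k : R) : 0 < a -> k <= a * lam ->
  mcp_closed a lam theta + (2 * a)^-1 * (k - mcp_argmin a lam theta) ^+ 2 <=
  (2 * a)^-1 * k ^+ 2 - (a^-1 * k - lam) * theta.
Proof.
move=> a0 ka; rewrite mcp_objE// lerD2l ler_pM2l ?invr_gt0 ?mulr_gt0//.
have : a * lam - theta <= Num.max (a * lam - theta) 0 by rewrite le_max lexx.
by rewrite /mcp_argmin; set p := Num.max _ _ => ps; nra.
Qed.

Lemma gstar_argminE (R : realType) (a lam theta : R) :
    0 < a -> 0 < lam -> 0 <= theta ->
  gstar_argmin a lam theta = [set mcp_argmin a lam theta].
Proof.
move=> a0 lam0 theta0.
have kin := mcp_argmin_in a0 lam0 theta0.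
apply/seteqP; split=> [k [/= kI kmin]|_ ->].
  have := kmin _ kin; rewrite mcp_obj_argmin// => kle.
  move: kI; rewrite in_itv/= => /andP[_ kal].
  have := le_trans (mcp_obj_ge theta a0 kal) kle.
  rewrite gerDl pmulr_rle0 ?invr_gt0 ?mulr_gt0// => sq0.
  apply/eqP; rewrite -subr_eq0 -sqrf_eq0 eq_le sq0/=; exact: sqr_ge0.
split=> // k /=; rewrite in_itv/= => /andP[_ kal].
rewrite mcp_obj_argmin// (le_trans _ (mcp_obj_ge theta a0 kal))// lerDl.
by rewrite mulr_ge0 ?sqr_ge0// invr_ge0 mulr_ge0// ltW.
Qed.

Lemma gstarE (R : realType) (a lam theta : R) :
  0 < a -> 0 < lam -> 0 <= theta -> gstar a lam theta = mcp_argmin a lam theta.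
Proof. by move=> *; rewrite /gstar gstar_argminE//; exact: get_unique. Qed.

(** * Derivatives on the half-line *)

(** At [x > 0] the two functions agree near [x]; at [0] they agree on the right,
    where the difference quotient of [g] converges a fortiori. This transfers
    the derivative of [mcp_closed], defined on the whole line, to the MCP. *)
Lemma is_derive_halfline_eq (R : realType) (f g : R -> R) (x l : R) :
    0 <= x -> (forall t, 0 <= t -> f t = g t) -> is_derive x 1 g l ->
  is_derive_halfline f x l.
Proof.
move=> x0 fg dg; rewrite /is_derive_halfline.
case: eqVneq => [xE|xN0]; last first.
  apply: near_eq_is_derive dg; near=> t; rewrite fg//; apply: ltW.
  near: t; by apply: lt_nbhsr; rewrite lt_neqAle eq_sym xN0.
have quot : h^-1 *: ((g \o shift 0) (h *: (1 : R)) - g 0) @[h --> 0^'] --> l.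
  by move: dg; rewrite xE => -[dg <-].
have := cvg_dnbhs_at_right quot; apply: cvg_trans; apply: near_eq_cvg.
near=> h; rewrite /= addr0 /GRing.scale/= mulr1 !fg//; exact: ltW.
Unshelve. all: by end_near. Qed.

Theorem proposition2p3 (R : realType) (a lam : R) (ha : 0 < a) (hlam : 0 < lam) :
  (forall (n d m : nat) (Q : 'M[R]_d) (q : 'cV[R]_d)
      (A : 'M[R]_(d, m)) (b : 'cV[R]_m),
    (1 <= n)%N -> (1 <= d)%N -> (m < d)%N ->
    Q^T = Q ->
    \rank A = m ->
    Lambda A b !=set0 ->
    argmin (Lambda A b) (L_obj n Q q (MCP a lam)) !=set0 ->
    forall beta : 'cV[R]_d,
      argmin (Lambda A b) (L_obj n Q q (MCP a lam)) beta <->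
      exists2 g : 'cV[R]_d, cube (a * lam) g &
        argmin (Lambda A b `*` cube (a * lam))
          (fun x => F_MCP n Q q a lam x.1 x.2) (beta, g)) /\
  (forall theta : R, 0 <= theta ->
    gstar_argmin a lam theta = [set gstar a lam theta] /\
    is_derive_halfline (MCP a lam) theta ((a * lam - gstar a lam theta) / a)).
Proof.
split=> [n d m Q q A b _ _ _ _ _ _ _ beta|theta theta0]; last first.
  rewrite gstarE// gstar_argminE//; split=> //.
  apply: (is_derive_halfline_eq theta0 (fun t => @MCP_closed_form _ _ _ t ha hlam)).
  by rewrite /mcp_argmin subKr; exact: is_derive_mcp_closed.
(* the best [g] for a given [beta] is obtained coordinate by coordinate *)
apply: (@argmin_partial _ _ _ _ _ _ (F_MCP n Q q a lam)
  (fun beta => \col_i mcp_argmin a lam `|beta i 0|)) => [x i|x|x g gcube].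
- by rewrite mxE; exact: mcp_argmin_in.
- rewrite /F_MCP /L_obj; congr (_ + _ * _); apply: eq_bigr => i _.
  by rewrite mxE mcp_obj_argmin// MCP_closed_form.
- rewrite lerD2l ler_wpM2l//; apply: ler_sum => i _.
  have := gcube i; rewrite in_itv/= => /andP[_ gi].
  rewrite MCP_closed_form// (le_trans _ (mcp_obj_ge _ ha gi))// lerDl.
  by rewrite mulr_ge0 ?sqr_ge0// invr_ge0 mulr_ge0// ltW.
Qed.
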